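(* Let $\theta\in[0,1]$ and let $\{t_n\}_{n=0}^{M}$ be an arbitrary partition $0=t_0<t_1<\dots<t_M=T$ of $[0,T]$, with $M\ge 2$. Let $(u_n^h,w_n^h,\xi_n^h,p_n^h,\phi_n^h,m_n^h)_{n=0}^{M}\subset X_h\times X_h\times Q_h\times Q_h\times\Phi_h\times\Phi_h$ be a solution of the fully discrete DLN scheme (S1)--(S6) described in the context. If $\rho\ge 0$, then the discrete model energy $$\mathcal{E}_n=\begin{Vmatrix}u_{n+1}^h\\ u_n^h\end{Vmatrix}_{G(\theta)}+\kappa\left(\begin{Vmatrix}\nabla\phi_{n+1}^h\\ \nabla\phi_n^h\end{Vmatrix}_{G(\theta)}+\int_D F(\phi_{n+1,\theta}^h)\,dx\right),\qquad n=0,1,\dots,M-1,$$ satisfies $$\mathcal{E}_{n+1}\le \mathcal{E}_n,\qquad n=0,1,\dots,M-2,$$ unconditionally, i.e. with no restriction whatsoever on the time step sizes $k_n=t_{n+1}-t_n$ or on the mesh size $h$. Thus the scheme is unconditionally stable in model energy under arbitrary time grids.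
   Context: **Domain, parameters, potential.** $D\subset\mathbb{R}^d$ ($d=2,3$) is a bounded domain with Lipschitz boundary, $T>0$. $(\cdot,\cdot)$ and $\|\cdot\|$ denote the $L^2(D)$ inner product and norm (for scalar, vector or matrix valued functions). The parameters satisfy $\mu,\gamma,\nu\ge0$, $\lambda\ge0$, $\rho\in\mathbb{R}$, $\sigma>0$, $\kappa>0$, $\eta>0$. Set $$F(\phi)=\frac{1}{4\eta^2}(\phi^2-1)^2,\qquad f(\phi)=F'(\phi)=\frac{\phi^3-\phi}{\eta^2}.$$ **Function spaces.** $X=\{v\in[H^1(D)]^d: v=0\text{ on }\partial D\}$, $Q=\{q\in L^2(D):\int_D q\,dx=0\}$, $\Phi=H^1(D)$. Let $\mathscr{T}_h$ ($0<h<1$) be a regular triangulation of $D$ with mesh size $h$, let $r\ge1$ be a fixed integer, and let $P_k(K)$ be the space of polynomials of degree at most $k$ on $K\in\mathscr{T}_h$. Define $$X_h=\{v^h\in[C^0(\bar D)]^d\cap X: v^h|_K\in P_{r+1}(K)\ \text{(componentwise)}\ \forall K\in\mathscr{T}_h\},$$ $$Q_h=\{q^h\in C^0(\bar D)\cap Q: q^h|_K\in P_r(K)\ \forall K\in\mathscr{T}_h\},$$ $$\Phi_h=\{\vartheta^h\in C^0(\bar D)\cap\Phi:\vartheta^h|_K\in P_{r+1}(K)\ \forall K\in\mathscr{T}_h\}.$$ The pair $(X_h,Q_h)$ satisfies the discrete inf-sup (LBB) condition: there is a constant $C>0$ with $\|q^h\|\le C\sup_{v^h\in X_h\setminus\{0\}}\frac{(\nabla\cdot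 v^h,q^h)}{\|\nabla v^h\|}$ for all $q^h\in Q_h$. **Trilinear form.** $b(u,v,w)=\frac12(u\cdot\nabla v,w)-\frac12(u\cdot\nabla w,v)$ for $u,v,w\in X$. **DLN coefficients.** Let $k_n=t_{n+1}-t_n$, $\varepsilon_n=\frac{k_n-k_{n-1}}{k_n+k_{n-1}}\in(-1,1)$, $$\alpha_2=\tfrac12(\theta+1),\quad \alpha_1=-\theta,\quad \alpha_0=\tfrac12(\theta-1),$$ $$\beta_2^{(n)}=\tfrac14\Big(1+\tfrac{1-\theta^2}{(1+\varepsilon_n\theta)^2}+\varepsilon_n^2\tfrac{\theta(1-\theta^2)}{(1+\varepsilon_n\theta)^2}+\theta\Big),\quad \beta_1^{(n)}=\tfrac12\Big(1-\tfrac{1-\theta^2}{(1+\varepsilon_n\theta)^2}\Big),$$ $$\beta_0^{(n)}=\tfrac14\Big(1+\tfrac{1-\theta^2}{(1+\varepsilon_n\theta)^2}-\varepsilon_n^2\tfrac{\theta(1-\theta^2)}{(1+\varepsilon_n\theta)^2}-\theta\Big),\qquad \widehat{k}_n=\alpha_2k_n-\alpha_0k_{n-1}.$$ For a sequence $\{z_n\}$ write $$z_{n,\theta}=\tfrac{1+\theta}{2}z_n+\tfrac{1-\theta}{2}z_{n-1},\qquad z_{n,\alpha}=\sum_{\ell=0}^2\alpha_\ell z_{n-1+\ell},\qquad z_{n,\beta}=\sum_{\ell=0}^2\beta_\ell^{(n)}z_{n-1+\ell}.$$ **$G$-norm.** For $L^2(D)$ (vector valued) functions $u,v$, $$\begin{Vmatrix}u\\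 v\end{Vmatrix}_{G(\theta)}=\tfrac14(1+\theta)\|u\|^2+\tfrac14(1-\theta)\|v\|^2$$ (no square root is taken). **Modified nonlinearity.** Pointwise in $D$, $$\widetilde f(\phi_{n+1,\theta}^h,\phi_{n,\theta}^h)=\begin{cases}\dfrac{F(\phi_{n+1,\theta}^h)-F(\phi_{n,\theta}^h)}{\phi_{n+1,\theta}^h-\phi_{n,\theta}^h},&\phi_{n+1,\theta}^h\ne\phi_{n,\theta}^h,\\[1ex] f\Big(\dfrac{\phi_{n+1,\theta}^h+\phi_{n,\theta}^h}{2}\Big),&\phi_{n+1,\theta}^h=\phi_{n,\theta}^h.\end{cases}$$ **The fully discrete DLN scheme.** For each $n=1,2,\dots,M-1$, given the values at levels $n-1$ and $n$, the values $(u_{n+1}^h,w_{n+1}^h,\xi_{n+1}^h,p_{n+1}^h,\phi_{n+1}^h,m_{n+1}^h)\in X_h\times X_h\times Q_h\times Q_h\times\Phi_h\times\Phi_h$ satisfy, for all $(v^h,\varphi^h,q^h,\zeta^h,\vartheta^h,\varsigma^h)\in X_h\times X_h\times Q_h\times Q_h\times\Phi_h\times\Phi_h$: (S1) $\frac{1}{\widehat{k}_n}(u_{n,\alpha}^h,v^h)+\mu(\nabla u_{n,\beta}^h,\nabla v^h)+\gamma(\nabla w_{n,\beta}^h,\nabla v^h)+\nu\, b(u_{n,\beta}^h,u_{n,\beta}^h,v^h)+\rho(u_{n,\beta}^h,v^h)+\lambda(|u_{n,\beta}^h|^2u_{n,\beta}^h,v^h)-(p_{n,\beta}^h,\nabla\cdot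 v^h)=(m_{n,\beta}^h\nabla\phi_{n,\beta}^h,v^h)$, (S2) $(w_{n+1}^h,\varphi^h)-(\xi_{n+1}^h,\nabla\cdot\varphi^h)=(\nabla u_{n+1}^h,\nabla\varphi^h)$, (S3) $(\nabla\cdot u_{n+1}^h,q^h)=0$, (S4) $(\nabla\cdot w_{n+1}^h,\zeta^h)=0$, (S5) $\frac{1}{\widehat{k}_n}(\phi_{n,\alpha}^h,\vartheta^h)+(u_{n,\beta}^h\cdot\nabla\phi_{n,\beta}^h,\vartheta^h)=-\sigma(m_{n,\beta}^h,\vartheta^h)$, (S6) $(m_{n,\beta}^h,\varsigma^h)=\kappa(\nabla\phi_{n,\beta}^h,\nabla\varsigma^h)+\kappa(\widetilde f(\phi_{n+1,\theta}^h,\phi_{n,\theta}^h),\varsigma^h)$. **Starting values.** The starting values at levels $0$ and $1$ belong to the same finite element spaces and satisfy the constraint equations (S2)--(S4), that is, those equations also hold with the index $n+1$ replaced by $0$ and by $1$. *)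

(* Defs.v *)
From HB Require Import structures.
From mathcomp Require Import all_boot all_order all_algebra.
From mathcomp Require Import all_classical all_reals all_analysis.
From mathcomp Require mpoly.
(* A full Import clashes with the notations of mathcomp-analysis. *)
Import (coercions, canonicals) mpoly.
Set Implicit Arguments.
Unset Strict Implicit.
Unset Printing Implicit Defensive.

Import Order.TTheory GRing.Theory Num.Theory numFieldNormedType.Exports.

Local Open Scope classical_set_scope.
Local Open Scope ring_scope.

Section RowMeasurable.
Variables (R : realType) (n : nat).

Let coord (i : 'I_n) (x : 'rV[R]_n) : R := x ord0 i.

Let rV_set0 : g_sigma_preimage coord set0.
Proof. exact: sigma_algebra0. Qed.

Let rV_setC A : g_sigma_preimage coord A -> g_sigma_preimage coord (~` A).
Proof. exact: sigma_algebraC. Qed.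

Let rV_bigcup (F : (set 'rV[R]_n)^nat) :
  (forall i, g_sigma_preimage coord (F i)) ->
  g_sigma_preimage coord (\bigcup_i F i).
Proof. exact: sigma_algebra_bigcup. Qed.

(* The product sigma-algebra, generated by the coordinate maps; for R^n it is
   the Borel sigma-algebra. *)
HB.instance Definition _ := @isMeasurable.Build default_measure_display
  'rV[R]_n (g_sigma_preimage coord) rV_set0 rV_setC rV_bigcup.

Lemma measurable_coord (i : 'I_n) :
  measurable_fun [set: 'rV[R]_n] (fun x : 'rV[R]_n => x ord0 i).
Proof.
move=> _ Y mY; rewrite setTI; apply: sub_sigma_algebra => /=.
rewrite -bigcup_seq/=; exists i => /=; first by rewrite mem_index_enum.
by exists Y => //; rewrite setTI.
Qed.

Lemma measurable_fun_coordP d (T : measurableType d) (f : T -> 'rV[R]_n) :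
  (forall i, measurable_fun [set: T] (fun x => f x ord0 i)) ->
  measurable_fun [set: T] f.
Proof.
move=> mf; suff sub : g_sigma_preimage (fun i => coord i \o f) `<=` measurable.
  rewrite g_sigma_preimage_comp in sub.
  by move=> _ A mA; apply: sub; exists A.
apply: smallest_sub; first exact: sigma_algebra_measurable.
move=> B; rewrite -bigcup_seq => -[i _ [A mA <-]].
exact: mf.
Qed.

End RowMeasurable.

Section LebesgueStep.
Variables (R : realType) (n : nat).
Variable mu : {sigma_finite_measure set 'rV[R]_n -> \bar R}.

Definition rV_cons (p : measurableTypeR R * 'rV[R]_n) : 'rV[R]_n.+1 :=
  \row_(i < n.+1) if unlift ord0 i is Some j then p.2 ord0 j else p.1.

Lemma measurable_rV_cons : measurable_fun [set: measurableTypeR R * 'rV[R]_n] rV_cons.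
Proof.
apply: measurable_fun_coordP => i.
under eq_fun do rewrite mxE.
case: (unliftP ord0 i) => [j|] _; last exact: measurable_fst.
exact: (measurableT_comp (measurable_coord j) measurable_snd).
Qed.

Definition lebesgue_cons : set 'rV[R]_n.+1 -> \bar R :=
  pushforward (@lebesgue_measure R \x mu)%E rV_cons.

Let prod_mu : {measure set (measurableTypeR R * 'rV[R]_n) -> \bar R} :=
  (@lebesgue_measure R \x mu)%E.

Let lebesgue_cons0 : lebesgue_cons set0 = 0%E.
Proof. by rewrite /lebesgue_cons /pushforward preimage_set0 measure0. Qed.

Let lebesgue_cons_ge0 A : (0 <= lebesgue_cons A)%E.
Proof. exact: (measure_ge0 prod_mu). Qed.

Let measurable_preimage A : measurable A -> measurable (rV_cons @^-1` A).
Proof. by move=> mA; rewrite -[X in measurable X]setTI; exact: measurable_rV_cons. Qed.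

Let lebesgue_cons_sigma_additive : semi_sigma_additive lebesgue_cons.
Proof.
move=> F mF tF mUF; rewrite /lebesgue_cons /pushforward preimage_bigcup.
apply: (@measure_semi_sigma_additive _ _ _ prod_mu
  (fun i => rV_cons @^-1` F i)).
- by move=> n0; exact: measurable_preimage.
- apply/trivIsetP => /= i j _ _ ij; rewrite -preimage_setI.
  by move/trivIsetP : tF => /(_ _ _ _ _ ij) ->//; rewrite preimage_set0.
- by rewrite -preimage_bigcup; exact: measurable_preimage.
Qed.

HB.instance Definition _ := isMeasure.Build _ _ _ lebesgue_cons
  lebesgue_cons0 lebesgue_cons_ge0 lebesgue_cons_sigma_additive.

Let rV_uncons (x : 'rV[R]_n.+1) : measurableTypeR R * 'rV[R]_n :=
  (x ord0 ord0, \row_j x ord0 (lift ord0 j)).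

Let rV_consK : cancel rV_cons rV_uncons.
Proof.
case=> a x; rewrite /rV_uncons !mxE unlift_none; congr pair.
by apply/rowP => j; rewrite !mxE liftK.
Qed.

Let measurable_rV_uncons : measurable_fun [set: 'rV[R]_n.+1] rV_uncons.
Proof.
apply/measurable_fun_pairP; split => /=; first exact: measurable_coord.
apply: measurable_fun_coordP => i.
under eq_fun do rewrite /= mxE.
exact: measurable_coord.
Qed.

Let lebesgue_cons_sigma_finite : sigma_finite [set: 'rV[R]_n.+1] lebesgue_cons.
Proof.
pose lebR : {sigma_finite_measure set (measurableTypeR R) -> \bar R} :=
  @lebesgue_measure R.
have [F FT Foo] : sigma_finite setT prod_mu.
  have /sigma_finiteP[A [AT ndA Aoo]] := sigma_finiteT lebR.
  have /sigma_finiteP[B [BT ndB Boo]] := sigma_finiteT mu.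
  exists (fun k => A k `*` B k).
    rewrite -setXTT AT BT predeqE => -[x y]; split.
      move=> [/= [k _ Akx] [l _ Bly]]; exists (maxn k l) => //; split.
      - by move: x Akx; exact/subsetPset/ndA/leq_maxl.
      - by move: y Bly; exact/subsetPset/ndB/leq_maxr.
    by move=> [k _ []/= ? ?]; split; exists k.
  move=> k; have [? ?] := Aoo k; have [? ?] := Boo k.
  split; first exact: measurableX.
  by rewrite /prod_mu /= product_measure1E// lte_mul_pinfty// ge0_fin_numE.
exists (fun k => rV_uncons @^-1` F k).
  by rewrite -preimage_bigcup -FT preimage_setT.
move=> k; have [mFk Fkoo] := Foo k; split.
  by rewrite -[X in measurable X]setTI; exact: measurable_rV_uncons.
rewrite /lebesgue_cons /pushforward -comp_preimage.
rewrite (_ : _ \o _ = id) ?preimage_id//.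
by apply/funext => p /=; rewrite rV_consK.
Qed.

HB.instance Definition _ := Measure_isSigmaFinite.Build _ _ _ lebesgue_cons
  lebesgue_cons_sigma_finite.

End LebesgueStep.

Fixpoint lebesgue_rV (R : realType) (n : nat) :
    {sigma_finite_measure set 'rV[R]_n -> \bar R} :=
  match n with
  | 0 => dirac (0 : 'rV[R]_0)
  | k.+1 => lebesgue_cons (lebesgue_rV R k)
  end.

Lemma lebesgue_rV_box (R : realType) (n : nat) (a b : 'rV[R]_n) :
  (forall i, a ord0 i <= b ord0 i) ->
  lebesgue_rV R n [set x | forall i, a ord0 i <= x ord0 i <= b ord0 i] =
  (\prod_(i < n) (b ord0 i - a ord0 i))%:E.
Proof.
elim: n a b => [|n IH] a b ab /=.
  by rewrite big_ord0 /= diracE mem_set//= => -[].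
pose tl (x : 'rV[R]_n.+1) : 'rV[R]_n := \row_j x ord0 (lift ord0 j).
rewrite /lebesgue_cons /pushforward.
pose I0 : set (measurableTypeR R) := `[a ord0 ord0, b ord0 ord0]%classic.
pose S := [set x : 'rV[R]_n | forall i, tl a ord0 i <= x ord0 i <= tl b ord0 i].
rewrite [X in product_measure1 _ _ X](_ : _ = I0 `*` S); last first.
  apply/seteqP; split => -[s x] /=.
    move=> H; split.
      by have := H ord0; rewrite !mxE unlift_none /I0 /= in_itv.
    by move=> i; have := H (lift ord0 i); rewrite !mxE liftK.
  rewrite /I0 /= in_itv /= => -[H0 H] i; rewrite mxE.
  case: (unliftP ord0 i) => [j ->|->] //.
  by have := H j; rewrite !mxE.
rewrite product_measure1E; last 2 first.
- exact: measurable_itv.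
- rewrite (_ : S = \bigcap_(i : 'I_n)
      ((fun x : 'rV[R]_n => x ord0 i) @^-1` `[tl a ord0 i, tl b ord0 i]%classic)).
    apply: fin_bigcap_measurable => [|i _]; first exact: finite_finset.
    rewrite -[X in measurable X]setTI; exact: measurable_coord.
  apply/seteqP; split => x /= H i; first by move=> _; rewrite /= in_itv /=.
  by have := H i I; rewrite /= in_itv.
rewrite IH; last by move=> i; rewrite !mxE.
rewrite big_ord_recl EFinM; congr (_ * _)%E; last first.
  by congr EFin; apply: eq_bigr => i _; rewrite !mxE.
apply: etrans (lebesgue_measure_itv `[a ord0 ord0, b ord0 ord0]) _.
rewrite /= lte_fin; case: ltP => // ba.
have /eqP <- : a ord0 ord0 == b ord0 ord0 by rewrite eq_le ab ba.
by rewrite subrr.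
Qed.

Section Domain.
Variables (R : realType) (d : nat).
Local Notation E := 'rV[R]_d.
Local Notation leb := (lebesgue_rV R d).

(* Frobenius product; for row vectors, the Euclidean dot product. *)
Definition frob (m n : nat) (A B : 'M[R]_(m, n)) : R :=
  \sum_i \sum_j A i j * B i j.

(* The library norm on matrices is the max norm, hence this one. *)
Definition enorm (x : E) : R := Num.sqrt (frob x x).

Definition boundary (D : set E) : set E := closure D `\` interior D.

(* Near each boundary point, D is the strict epigraph, in some unit direction
   e, of a Lipschitz function g on the hyperplane orthogonal to e. *)
Definition lipschitz_boundary (D : set E) : Prop :=
  forall x, boundary D x ->
  exists (e : E) (r L : R) (g : E -> R),
    [/\ frob e e = 1, 0 < r,
        forall y z, `|g y - g z| <= L * enorm (y - z) &
        forall z, enorm (z - x) < r ->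
          (D z <-> g (z - frob z e *: e) < frob z e)].

Definition lipschitz_domain (D : set E) : Prop :=
  [/\ open D, connected D, D !=set0, bounded_set D & lipschitz_boundary D].

Definition ip (D : set E) (m n : nat) (f g : E -> 'M[R]_(m, n)) : R :=
  \int[leb]_(x in D) frob (f x) (g x).

Definition ips (D : set E) (f g : E -> R) : R := \int[leb]_(x in D) (f x * g x).

Definition normL2 (D : set E) (m n : nat) (f : E -> 'M[R]_(m, n)) : R :=
  Num.sqrt (ip D f f).

Definition normL2s (D : set E) (f : E -> R) : R := Num.sqrt (ips D f f).

Definition inL2 (D : set E) (f : E -> R) : Prop := f \_ D \in Lfun leb 2%:E.

Fixpoint Ck (k : nat) (f : E -> R) : Prop :=
  continuous f /\
  if k is l.+1 then
    forall i : 'I_d,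
      (forall x, derivable f x (delta_mx ord0 i)) /\
      Ck l (fun x => 'D_(delta_mx ord0 i) f x)
  else True.

Definition test_function (D : set E) (psi : E -> R) : Prop :=
  (forall k, Ck k psi) /\
  exists K : set E, [/\ compact K, K `<=` D & forall x, ~ K x -> psi x = 0].

Definition weak_gradient (D : set E) (v : E -> R) (g : E -> 'rV[R]_d) : Prop :=
  forall psi, test_function D psi -> forall i : 'I_d,
    \int[leb]_(x in D) (v x * 'D_(delta_mx ord0 i) psi x) =
    - \int[leb]_(x in D) (g x ord0 i * psi x).

End Domain.

(* An element of H^1(D) is encoded as a pair (v, grad v) in L^2 x (L^2)^d whose
   second component is a weak gradient of the first, that is, H^1(D) is seen as
   the usual closed subspace of L^2 x (L^2)^d.  Linear combinations are those of
   the product module of functions, so that they act on v and grad v at once.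
   In the vector valued case row i of the gradient is the gradient of v_i. *)
Notation sfield R d := (('rV[R]_d -> R) * ('rV[R]_d -> 'rV[R]_d))%type.
Notation vfield R d := (('rV[R]_d -> 'rV[R]_d) * ('rV[R]_d -> 'M[R]_d))%type.

Definition fn (A B : Type) (v : A * B) : A := v.1.
Definition grad (A B : Type) (v : A * B) : B := v.2.

Section Spaces.
Variables (R : realType) (d : nat).
Local Notation E := 'rV[R]_d.
Local Notation leb := (lebesgue_rV R d).

Definition divg (v : vfield R d) : E -> R := fun x => \tr (grad v x).

Definition inH1 (D : set E) (v : sfield R d) : Prop :=
  [/\ inL2 D (fn v),
      forall i : 'I_d, inL2 D (fun x => grad v x ord0 i) &
      weak_gradient D (fn v) (grad v)].

Definition comp (v : vfield R d) (i : 'I_d) : sfield R d :=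
  (fun x => fn v x ord0 i, fun x => row i (grad v x)).

Definition inH1v (D : set E) (v : vfield R d) : Prop :=
  forall i, inH1 D (comp v i).

Definition inL2_mean0 (D : set E) (q : E -> R) : Prop :=
  inL2 D q /\ \int[leb]_(x in D) q x = 0.

(* The rows of K are the d + 1 vertices of the simplex; a face is the convex
   hull of the vertices whose indices lie in J (empty if J is empty). *)
Definition face (K : 'M[R]_(d.+1, d)) (J : {set 'I_d.+1}) : set E :=
  [set x | exists l : 'rV[R]_d.+1,
     [/\ forall i, 0 <= l ord0 i, forall i, i \notin J -> l ord0 i = 0,
         \sum_i l ord0 i = 1 & x = l *m K]].

Definition simplex (K : 'M[R]_(d.+1, d)) : set E := face K [set: 'I_d.+1]%SET.

Definition nondegenerate (K : 'M[R]_(d.+1, d)) : Prop :=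
  \det (\matrix_(i < d, j < d) (K (lift ord0 i) j - K ord0 j)) != 0.

(* Conforming, with mesh size h (the largest diameter), and shape regular with
   constant creg: diam K <= creg * (diameter of some ball inside K). *)
Definition regular_triangulation (D : set E) (h creg : R)
    (Th : seq 'M[R]_(d.+1, d)) : Prop :=
  [/\ forall K, K \in Th -> nondegenerate K,
      forall x, closure D x <-> exists2 K, K \in Th & simplex K x,
      forall K L, K \in Th -> L \in Th ->
        exists I J : {set 'I_d.+1},
          simplex K `&` simplex L = face K I /\ face K I = face L J,
      (forall K x y, K \in Th -> simplex K x -> simplex K y ->
         enorm (x - y) <= h) /\
      (exists K x y, [/\ K \in Th, simplex K x, simplex K y & enorm (x - y) = h])
    & forall K, K \in Th -> exists (c : E) (s : R),
        [/\ 0 < s, forall x, enorm (x - c) <= s -> simplex K x &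
            forall x y, simplex K x -> simplex K y ->
              enorm (x - y) <= creg * (2 * s)]].

Definition polynomial_on (k : nat) (A : set E) (f : E -> R) : Prop :=
  exists p : mpoly.mpoly d R, (mpoly.msize p <= k.+1)%N /\
    forall x, A x -> f x = mpoly.meval (fun i => x ord0 i) p.

(* X = H^1 functions vanishing on the boundary; for functions continuous on the
   closure of D the trace is the pointwise restriction. *)
Definition Xh (D : set E) (Th : seq 'M[R]_(d.+1, d)) (r : nat)
    (v : vfield R d) : Prop :=
  [/\ inH1v D v, {within closure D, continuous (fn v)},
      forall x, boundary D x -> fn v x = 0 &
      forall K i, K \in Th ->
        polynomial_on r.+1 (simplex K) (fun x => fn v x ord0 i)].

Definition Qh (D : set E) (Th : seq 'M[R]_(d.+1, d)) (r : nat)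
    (q : E -> R) : Prop :=
  [/\ inL2_mean0 D q, {within closure D, continuous q} &
      forall K, K \in Th -> polynomial_on r (simplex K) q].

Definition Phih (D : set E) (Th : seq 'M[R]_(d.+1, d)) (r : nat)
    (v : sfield R d) : Prop :=
  [/\ inH1 D v, {within closure D, continuous (fn v)} &
      forall K, K \in Th -> polynomial_on r.+1 (simplex K) (fn v)].

Definition inf_sup (D : set E) (Th : seq 'M[R]_(d.+1, d)) (r : nat) : Prop :=
  exists2 C : R, 0 < C & forall q, Qh D Th r q ->
    ((normL2s D q)%:E <=
     C%:E * ereal_sup [set (ips D (divg v) q / normL2 D (grad v))%:E
                      | v in [set v | Xh D Th r v /\
                                      exists2 x, D x & fn v x != 0%R]])%E.

(* (u . grad v)_i = sum_j u_j d_j v_i *)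
Definition convect (u v : vfield R d) : E -> 'rV[R]_d :=
  fun x => fn u x *m (grad v x)^T.

Definition bform (D : set E) (u v w : vfield R d) : R :=
  2^-1 * ip D (convect u v) (fn w) - 2^-1 * ip D (convect u w) (fn v).

End Spaces.

Section DLN.
Variables (R : realType) (theta : R) (t : nat -> R).

Definition kstep (n : nat) : R := t n.+1 - t n.

(* Everything indexed by n from here to at_beta is meant for n >= 1, where n.-1
   is the true predecessor. *)
Definition veps (n : nat) : R :=
  (kstep n - kstep n.-1) / (kstep n + kstep n.-1).

Definition alpha2 : R := 2^-1 * (theta + 1).
Definition alpha1 : R := - theta.
Definition alpha0 : R := 2^-1 * (theta - 1).

Definition beta2 (n : nat) : R :=
  4^-1 * (1 + (1 - theta ^+ 2) / (1 + veps n * theta) ^+ 2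
          + veps n ^+ 2 * (theta * (1 - theta ^+ 2)
                           / (1 + veps n * theta) ^+ 2) + theta).
Definition beta1 (n : nat) : R :=
  2^-1 * (1 - (1 - theta ^+ 2) / (1 + veps n * theta) ^+ 2).
Definition beta0 (n : nat) : R :=
  4^-1 * (1 + (1 - theta ^+ 2) / (1 + veps n * theta) ^+ 2
          - veps n ^+ 2 * (theta * (1 - theta ^+ 2)
                           / (1 + veps n * theta) ^+ 2) - theta).

Definition khat (n : nat) : R := alpha2 * kstep n - alpha0 * kstep n.-1.

Variable V : lmodType R.
Implicit Type z : nat -> V.

Definition at_theta z (n : nat) : V :=
  ((1 + theta) / 2) *: z n + ((1 - theta) / 2) *: z n.-1.
Definition at_alpha z (n : nat) : V :=
  alpha2 *: z n.+1 + alpha1 *: z n + alpha0 *: z n.-1.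
Definition at_beta z (n : nat) : V :=
  beta2 n *: z n.+1 + beta1 n *: z n + beta0 n *: z n.-1.

End DLN.

Record params (R : realType) := Params {
  mu : R; gamma : R; nu : R; lambda : R; rho : R;
  sigma : R; kappa : R; eta : R }.

Definition admissible (R : realType) (c : params R) : Prop :=
  [/\ [/\ 0 <= mu c, 0 <= gamma c & 0 <= nu c], 0 <= lambda c,
      0 < sigma c, 0 < kappa c & 0 < eta c].

Section Scheme.
Variables (R : realType) (d : nat) (D : set 'rV[R]_d).
Variables (Th : seq 'M[R]_(d.+1, d)) (r : nat).
Variables (c : params R) (theta : R) (t : nat -> R) (M : nat).
Local Notation E := 'rV[R]_d.

Definition Fpot (a : R) : R := (4 * eta c ^+ 2)^-1 * (a ^+ 2 - 1) ^+ 2.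
Definition fpot (a : R) : R := (a ^+ 3 - a) / eta c ^+ 2.

Definition ftilde (a b : R) : R :=
  if a != b then (Fpot a - Fpot b) / (a - b) else fpot ((a + b) / 2).

Variables (u w : nat -> vfield R d) (xi p : nat -> E -> R).
Variables (phi m : nat -> sfield R d).

Let alpha (V : lmodType R) (z : nat -> V) n : V := at_alpha theta z n.
Let beta (V : lmodType R) (z : nat -> V) n : V := at_beta theta t z n.

Definition momentum_eq (n : nat) : Prop :=
  forall v, Xh D Th r v ->
    (khat theta t n)^-1 * ip D (fn (alpha u n)) (fn v)
    + mu c * ip D (grad (beta u n)) (grad v)
    + gamma c * ip D (grad (beta w n)) (grad v)
    + nu c * bform D (beta u n) (beta u n) v
    + rho c * ip D (fn (beta u n)) (fn v)
    + lambda c * ip D (fun x => frob (fn (beta u n) x) (fn (beta u n) x)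
                                *: fn (beta u n) x) (fn v)
    - ips D (beta p n) (divg v)
    = ip D (fun x => fn (beta m n) x *: grad (beta phi n) x) (fn v).

Definition constraint_eqs (n : nat) : Prop :=
  [/\ forall v, Xh D Th r v ->
        ip D (fn (w n)) (fn v) - ips D (xi n) (divg v) =
        ip D (grad (u n)) (grad v),
      forall q, Qh D Th r q -> ips D (divg (u n)) q = 0 &
      forall q, Qh D Th r q -> ips D (divg (w n)) q = 0].

Definition phase_eq (n : nat) : Prop :=
  forall s, Phih D Th r s ->
    (khat theta t n)^-1 * ips D (fn (alpha phi n)) (fn s)
    + ips D (fun x => frob (fn (beta u n) x) (grad (beta phi n) x)) (fn s)
    = - sigma c * ips D (fn (beta m n)) (fn s).

Definition potential_eq (n : nat) : Prop :=
  forall s, Phih D Th r s ->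
    ips D (fn (beta m n)) (fn s) =
    kappa c * ip D (grad (beta phi n)) (grad s)
    + kappa c * ips D (fun x => ftilde (fn (at_theta theta phi n.+1) x)
                                       (fn (at_theta theta phi n) x)) (fn s).

Definition dln_solution : Prop :=
  [/\ forall n, (n <= M)%N ->
        [/\ Xh D Th r (u n), Xh D Th r (w n), Qh D Th r (xi n) /\ Qh D Th r (p n),
            Phih D Th r (phi n) & Phih D Th r (m n)],
      constraint_eqs 0, constraint_eqs 1 &
      forall n, (1 <= n < M)%N ->
        [/\ momentum_eq n, constraint_eqs n.+1, phase_eq n & potential_eq n]].

Definition Gnorm (k l : nat) (f g : E -> 'M[R]_(k, l)) : R :=
  4^-1 * (1 + theta) * normL2 D f ^+ 2 + 4^-1 * (1 - theta) * normL2 D g ^+ 2.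

Definition energy (n : nat) : R :=
  Gnorm (fn (u n.+1)) (fn (u n))
  + kappa c * (Gnorm (grad (phi n.+1)) (grad (phi n))
               + \int[lebesgue_rV R d]_(x in D)
                   Fpot (fn (at_theta theta phi n.+1) x)).

End Scheme.

(* Main.v *)
Require Import Defs.
From mathcomp Require Import all_boot all_order all_algebra.
From mathcomp Require Import all_classical all_reals all_analysis.
From mathcomp Require Import measurable_realfun.
From mathcomp Require mpoly.
From mathcomp Require Import ring lra.
Import Order.TTheory GRing.Theory Num.Theory numFieldNormedType.Exports.

Set Implicit Arguments.
Unset Strict Implicit.
Unset Printing Implicit Defensive.

Local Open Scope classical_set_scope.
Local Open Scope ring_scope.

(** The proof is the discrete energy law of the scheme.

Fix a step n >= 1, and test the momentum equation with u_beta, the phase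
equation with m_beta and the potential equation with phi_alpha.  In the first
one the convective term vanishes because b(u, u, u) = 0, the pressure term
vanishes because u_beta is discretely divergence free, and the viscous, drag
and cubic terms are nonnegative.  The term in grad w_beta is nonnegative too:
the constraint equations, which hold at all time levels and therefore for the
beta averages, turn (grad w_beta, grad u_beta) into the squared norm of w_beta
([coupling_work_ge0]).  The capillary force (m_beta grad phi_beta, u_beta) is
exactly the transport term of the phase equation, so that it cancels in the
sum, and there remains
   (u_alpha, u_beta) + (phi_alpha, m_beta) <= - khat * sigma * |m_beta|^2 <= 0.

The potential equation rewrites the second summand as
   kappa (grad phi_beta, grad phi_alpha) + kappa (ftilde, phi_alpha).
Two algebraic facts about the DLN coefficients then produce the energy.  Since
z_alpha is the increment of the sequence z_theta ([at_alphaE]), the difference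
quotient ftilde multiplied by phi_alpha is the increment of F(phi_theta)
([potential_increment]).  And (z_alpha, z_beta) equals the increment of the
G-norm plus a nonnegative multiple of a squared norm ([G_stability]); this
holds for every ratio of consecutive steps, which is why no condition on the
time grid appears.

The analytic work consists in making these manipulations legitimate.  The test
fields must lie in the finite element spaces, which are closed under linear
combinations ([Xh_lin], [Phih_lin]); for the weak gradient this requires test
functions and their derivatives to be square integrable on D, hence Borel
measurability of continuous functions on R^d and finiteness of the measure of
D.  The same facts make F(phi_theta) integrable ([Fpot_integrable]), so that
the integral of its increment splits. *)

(** * Open sets and bounded sets for the Lebesgue measure on R^n *)

(** The sigma-algebra is generated by the coordinates, so the point is that an
open set is a countable union of boxes, here the cubes of rational centre and
radius 1/(k+1) that it contains. *)
Lemma open_measurable_rV (R : realType) n (A : set 'rV[R]_n) :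
  open A -> measurable A.
Proof.
move=> oA.
pose B (q : nat * 'rV[rat]_n) : set 'rV[R]_n :=
  \bigcap_(i : 'I_n) ((fun x : 'rV[R]_n => x ord0 i) @^-1`
     ball (ratr (q.2 ord0 i) : R) q.1.+1%:R^-1).
have -> : A = \bigcup_q (if `[< B q `<=` A >] then B q else set0).
  apply/seteqP; split => [x Ax|x [q _]]; last by case: asboolP => // BA /BA.
  have [e /= e0 xeA] : exists2 e : R, 0 < e & ball x e `<=` A.
    by move: oA; rewrite openE => /(_ _ Ax) /nbhs_ballP.
  have [k ke] : exists k : nat, k.+1%:R^-1 < e / 2.
    have e2 : 0 < e / 2 by rewrite divr_gt0.
    exists (Num.truncn (e / 2)^-1); rewrite invf_plt ?posrE ?ltr0Sn//.
    exact: truncnS_gt.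
  have [q xq] : exists q : 'rV[rat]_n,
      forall i, ball (ratr (q ord0 i) : R) k.+1%:R^-1 (x ord0 i).
    have /choice[f fP] : forall i : 'I_n, exists q : rat,
        ball (ratr q : R) k.+1%:R^-1 (x ord0 i).
      move=> i; have [|q] :=
        @rat_in_itvoo R (x ord0 i - k.+1%:R^-1) (x ord0 i + k.+1%:R^-1).
        by rewrite ltrD2l gtrN// invr_gt0 ltr0Sn.
      rewrite in_itv/= => H; exists q.
      by rewrite /ball/= distrC ltr_distlC.
    by exists (\row_i f i) => i; rewrite mxE.
  exists (k, q) => //; rewrite asboolT; first by move=> i _; exact: xq.
  (* x and y are both within 1/(k+1) < e/2 of the centre q *)
  move=> y By; apply: xeA; split => // i j; rewrite ord1.
  apply: le_ball (ltW (_ : k.+1%:R^-1 + k.+1%:R^-1 < e)) _ _.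
    by rewrite [ltRHS]splitr ltrD.
  by apply: ball_triangle (By j I); apply: ball_sym; exact: xq.
apply: countable_bigcupT_measurable => // q; case: asboolP => // _.
apply: fin_bigcap_measurable => [|i _]; first exact: finite_finset.
rewrite -[X in measurable X]setTI; apply: measurable_coord => //.
apply: open_measurable; apply: ball_open; rewrite invr_gt0 ltr0Sn.
Qed.

Lemma continuous_measurable_rV (R : realType) n (f : 'rV[R]_n -> R) :
  continuous f -> measurable_fun [set: 'rV[R]_n] f.
Proof.
move=> /continuousP cf; apply: (measurability _ (RGenOpens.measurableE R)).
move=> _ [_ [a [b ->] <-]]; rewrite setTI.
apply: open_measurable_rV; apply: cf; exact: interval_open.
Qed.

Lemma lebesgue_rV_bounded_lty (R : realType) n (D : set 'rV[R]_n) :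
  measurable D -> bounded_set D -> (lebesgue_rV R n D < +oo)%E.
Proof.
move=> mD [N [_ bD]].
pose K := `|N| + 1.
have K0 : 0 <= K by rewrite addr_ge0.
pose C := [set x : 'rV[R]_n |
  forall i, (const_mx (- K) : 'rV[R]_n) ord0 i <= x ord0 i
              <= (const_mx K : 'rV[R]_n) ord0 i].
have DC : D `<=` C.
  move=> x /bD xN i; rewrite !mxE -ler_norml.
  have xK : `|x| <= K by apply: xN; rewrite (le_lt_trans (ler_norm N))// ltrDl.
  apply: le_trans xK; rewrite [leRHS]/Num.norm /= mx_normrE.
  exact: (le_bigmax _ (fun ij : 'I_1 * 'I_n => `|x ij.1 ij.2|) (ord0, i)).
have mC : measurable C.
  rewrite (_ : C = \bigcap_(i : 'I_n)
      ((fun x : 'rV[R]_n => x ord0 i) @^-1` `[- K, K]%classic)).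
    apply: fin_bigcap_measurable => [|i _]; first exact: finite_finset.
    by rewrite -[X in measurable X]setTI; exact: measurable_coord.
  apply/seteqP; split => x /= H i; first by move=> _; have := H i; rewrite /= in_itv !mxE.
  by have := H i I; rewrite /= in_itv !mxE.
apply: (@le_lt_trans _ _ (lebesgue_rV R n C)).
  by apply: le_measure => //; rewrite inE.
by rewrite lebesgue_rV_box ?ltry// => i; rewrite !mxE ge0_cp.
Qed.

(** * Polynomials and the Frobenius product *)

Section Polynomials.
Import (coercions, canonicals) mpoly.

Lemma polynomial_on_lin (R : realType) (d : nat) k (A : set 'rV[R]_d) a
    (f g : 'rV[R]_d -> R) :
  polynomial_on k A f -> polynomial_on k A g ->
  polynomial_on k A (fun x => a * f x + g x).
Proof.
move=> [p [pk fp]] [q [qk gq]].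
exists (a *: p + q); split.
  rewrite (leq_trans (mpoly.msizeD_le _ _))// geq_max qk andbT.
  exact: leq_trans (mpoly.msizeZ_le _ _) pk.
by move=> x Ax; rewrite mpoly.mevalD mpoly.mevalZ fp// gq.
Qed.

End Polynomials.

Lemma frob_ge0 (R : realType) m k (A : 'M[R]_(m, k)) : 0 <= frob A A.
Proof.
by apply: sumr_ge0 => i _; apply: sumr_ge0 => j _; rewrite -expr2 sqr_ge0.
Qed.

Lemma frobC (R : realType) m k (A B : 'M[R]_(m, k)) : frob A B = frob B A.
Proof. by apply: eq_bigr => i _; apply: eq_bigr => j _; rewrite mulrC. Qed.

Lemma frobZl (R : realType) m k a (A B : 'M[R]_(m, k)) :
  frob (a *: A) B = a * frob A B.
Proof.
rewrite /frob mulr_sumr; apply: eq_bigr => i _.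
by rewrite mulr_sumr; apply: eq_bigr => j _; rewrite !mxE mulrA.
Qed.

(** * Square integrable functions and their inner products *)

Section L2.
Variables (R : realType) (d : nat) (D : set 'rV[R]_d).
Hypothesis mD : measurable D.
Local Notation E := 'rV[R]_d.
Local Notation leb := (lebesgue_rV R d).

Lemma inL2_lin a (f g : E -> R) :
  inL2 D f -> inL2 D g -> inL2 D (fun x => a * f x + g x).
Proof.
rewrite /inL2 => fL gL.
have -> : (fun x => a * f x + g x) \_ D = a *: (f \_ D) + (g \_ D).
  by apply/funext => x; rewrite /patch !fctE/=; case: ifP => //; rewrite scaler0 addr0.
have le12 : (1 <= 2%:E :> \bar R)%E by rewrite lee_fin ler1n.
by have [_] := Lfun_submod_closed leb le12; apply.
Qed.

Lemma inL2_measurable (f : E -> R) : inL2 D f -> measurable_fun D f.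
Proof.
move=> /andP[mf _]; apply/(measurable_restrictT _ mD).
by move: mf; rewrite inE.
Qed.

Lemma inL2_integrableM (f g : E -> R) : inL2 D f -> inL2 D g ->
  leb.-integrable D (EFin \o (f \* g)).
Proof.
move=> fL gL; apply/(integrable_mkcond _ mD).
have := Lfun2_mul_Lfun1 fL gL => /Lfun1_integrable.
congr integrable; apply/funext => x; rewrite /patch/=.
by case: ifP => //; rewrite mulr0.
Qed.

Hypothesis Dfin : (leb D < +oo)%E.

Lemma bounded_inL2 (f : E -> R) : measurable_fun D f ->
  [bounded f x | x in D] -> inL2 D f.
Proof.
move=> mf bf.
have mfD : measurable_fun setT (f \_ D) by apply/(measurable_restrictT _ mD).
rewrite /inL2; apply/andP; split; first by rewrite inE.
rewrite inE/= /finite_norm unlock /Lnorm poweR_lty//.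
have : leb.-integrable D (EFin \o (fun x => f x * f x)).
  apply: measurable_bounded_integrable => //; first exact: measurable_funM.
  case: bf => N [Nr bN]; exists ((`|N| + 1) ^+ 2); split; first exact: num_real.
  move=> K NK x Dx; apply: le_trans (ltW NK); rewrite normrM -expr2 lerXn2r ?nnegrE//.
  by apply: bN => //; rewrite (le_lt_trans (ler_norm N))// ltrDl.
move=> /(integrable_mkcond _ mD)/integrableP[_]; apply: le_lt_trans.
apply: ge0_le_integral => //=.
- apply/measurable_EFinP.
  apply/(@measurableT_comp _ _ _ _ _ _ (fun x : R => x `^ 2)%R) => //.
  exact/measurableT_comp.
- apply: measurableT_comp => //; apply/(measurable_restrictT _ mD).
  by apply/measurable_EFinP; exact: measurable_funM.
move=> x _; rewrite /patch; case: ifP => _ /=.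
  by rewrite -expr2 normrX powR_mulrn.
by rewrite !normr0 powR0.
Qed.

Hypothesis bD : bounded_set D.

(** The closure of D is closed and bounded, hence compact. *)
Lemma continuous_bounded (V : normedModType R) (f : E -> V) :
  {within closure D, continuous f} -> [bounded f x | x in D].
Proof.
move=> cf; have cD : compact (closure D).
  apply: bounded_closed_compact; last exact: closed_closure.
  case: bD => N [Nr bN]; exists N; split => // K NK x.
  have DK : D `<=` closed_ball_ Num.Def.normr 0 K.
    by move=> y /(bN _ NK); rewrite /closed_ball_/= sub0r normrN.
  move=> /(closure_subset DK)/closed_closed_ball_.
  by rewrite /closed_ball_/= sub0r normrN.
have [N [Nr bN]] := compact_bounded (continuous_compact cf cD).
exists N; split => // K NK x Dx; apply: (bN _ NK).
by exists x => //; exact: subset_closure.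
Qed.

Lemma continuous_inL2 (f : E -> R) : continuous f -> inL2 D f.
Proof.
move=> cf; apply: bounded_inL2; last exact/continuous_bounded/continuous_subspaceT.
by apply: measurable_funTS; exact: continuous_measurable_rV.
Qed.

(** This and the next lemma make both sides of the identity defining the weak
gradient linear in the pair formed by the function and its gradient. *)
Lemma test_function_inL2 (psi : E -> R) : test_function D psi -> inL2 D psi.
Proof. by case=> /(_ 0)[cpsi _] _; exact: continuous_inL2. Qed.

Lemma test_function_derive_inL2 (psi : E -> R) i : test_function D psi ->
  inL2 D (fun x => 'D_(delta_mx ord0 i) psi x).
Proof. by case=> /(_ 1)[_ /(_ i)[_ [cpsi _]]] _; exact: continuous_inL2. Qed.

Definition inL2m m n (f : E -> 'M[R]_(m, n)) : Prop :=
  forall i j, inL2 D (fun x => f x i j).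

Lemma inL2_0 : inL2 D (fun=> 0).
Proof. by apply: continuous_inL2 => x; exact: cst_continuous. Qed.

Lemma inL2_sum (I : Type) (s : seq I) (f : I -> E -> R) :
  (forall i, inL2 D (f i)) -> inL2 D (fun x => \sum_(i <- s) f i x).
Proof.
move=> fL; elim: s => [|i s IH].
  by under eq_fun do rewrite big_nil; exact: inL2_0.
under eq_fun do rewrite big_cons -[f i _]mul1r.
exact: inL2_lin.
Qed.

Lemma ips_linl a (f g k : E -> R) : inL2 D f -> inL2 D g -> inL2 D k ->
  ips D (fun x => a * f x + g x) k = a * ips D f k + ips D g k.
Proof.
move=> fL gL kL; rewrite /ips.
under eq_Rintegral do rewrite mulrDl -mulrA.
have fk := inL2_integrableM fL kL; have gk := inL2_integrableM gL kL.
rewrite -(RintegralZl _ mD fk) -RintegralD//.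
by apply: eq_integrable (integrableZl mD a fk) => // x _ /=; rewrite EFinM.
Qed.

Lemma ipsC (f g : E -> R) : ips D f g = ips D g f.
Proof. by rewrite /ips; under eq_Rintegral do rewrite mulrC. Qed.

Lemma ips_linr a (f g k : E -> R) : inL2 D f -> inL2 D g -> inL2 D k ->
  ips D k (fun x => a * f x + g x) = a * ips D k f + ips D k g.
Proof. by move=> *; rewrite ipsC ips_linl// !(ipsC k). Qed.

Lemma inL2m_lin m n a (f g : E -> 'M[R]_(m, n)) :
  inL2m f -> inL2m g -> inL2m (a *: f + g).
Proof.
move=> fL gL i j; rewrite (_ : (fun x => _) = fun x => a * f x i j + g x i j).
  exact: inL2_lin.
by apply/funext => x; rewrite !fctE !mxE.
Qed.

Lemma Rintegral_sum (I : Type) (s : seq I) (f : I -> E -> R) :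
  (forall i, leb.-integrable D (EFin \o f i)) ->
  \int[leb]_(x in D) (\sum_(i <- s) f i x) = \sum_(i <- s) \int[leb]_(x in D) f i x.
Proof.
move=> fI.
elim: s => [|i s IH].
  rewrite big_nil; under eq_Rintegral do rewrite big_nil.
  by rewrite Rintegral_cst// mul0r.
rewrite big_cons -IH; under eq_Rintegral do rewrite big_cons.
rewrite RintegralD//.
rewrite (_ : EFin \o _ = (fun x => \sum_(j <- s) (EFin \o f j) x)%E).
  exact: integrable_sum.
by apply/funext => x /=; rewrite sumEFin.
Qed.

(** Reduces the bilinearity of the matrix inner product to that of the scalar
one; the square integrability is what allows exchanging integral and sum. *)
Lemma ipE m n (f g : E -> 'M[R]_(m, n)) : inL2m f -> inL2m g ->
  ip D f g = \sum_i \sum_j ips D (fun x => f x i j) (fun x => g x i j).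
Proof.
move=> fL gL; rewrite /ip /frob.
under eq_Rintegral do rewrite pair_bigA/=.
rewrite pair_bigA/= Rintegral_sum// => ij.
exact: inL2_integrableM (fL ij.1 ij.2) (gL ij.1 ij.2).
Qed.

Lemma ip_linl m n a (f g k : E -> 'M[R]_(m, n)) :
  inL2m f -> inL2m g -> inL2m k ->
  ip D (a *: f + g) k = a * ip D f k + ip D g k.
Proof.
move=> fL gL kL; rewrite !ipE//; last exact: inL2m_lin.
rewrite mulr_sumr -big_split/=; apply: eq_bigr => i _.
rewrite mulr_sumr -big_split/=; apply: eq_bigr => j _.
rewrite -ips_linl//; congr ips.
by apply/funext => x; rewrite !fctE !mxE.
Qed.

Lemma ipC m n (f g : E -> 'M[R]_(m, n)) : ip D f g = ip D g f.
Proof. by apply: eq_Rintegral => x _; rewrite frobC. Qed.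

Lemma ip_ge0 m n (f : E -> 'M[R]_(m, n)) : 0 <= ip D f f.
Proof. by apply: Rintegral_ge0 => x _; exact: frob_ge0. Qed.

Lemma normL2_sqr m n (f : E -> 'M[R]_(m, n)) : normL2 D f ^+ 2 = ip D f f.
Proof. by rewrite sqr_sqrtr// ip_ge0. Qed.

(** * Linearity of the function spaces *)

Lemma inH1_lin a (v w : sfield R d) : inH1 D v -> inH1 D w -> inH1 D (a *: v + w).
Proof.
move=> [vL gvL wv] [wL gwL ww]; split.
- exact: inL2_lin.
- move=> i; rewrite (_ : (fun x => _) = fun x => a * grad v x ord0 i + grad w x ord0 i).
    exact: inL2_lin.
  by apply/funext => x; rewrite /grad/= !fctE !mxE.
- move=> psi tpsi i; have p0 := test_function_inL2 tpsi.
  have p1 := test_function_derive_inL2 i tpsi.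
  have -> : \int[leb]_(x in D) (fn (a *: v + w) x * 'D_(delta_mx ord0 i) psi x) =
      a * ips D (fn v) ('D_(delta_mx ord0 i) psi) + ips D (fn w) ('D_(delta_mx ord0 i) psi).
    by rewrite -ips_linl.
  rewrite /ips wv// ww// mulrN -opprD; congr (- _).
  rewrite -[X in a * X]/(ips D (fun x => grad v x ord0 i) psi).
  rewrite -[X in _ + X]/(ips D (fun x => grad w x ord0 i) psi) -ips_linl//.
  by apply: eq_Rintegral => x _; rewrite /grad/= !fctE !mxE.
Qed.

Lemma inH1v_lin a (v w : vfield R d) : inH1v D v -> inH1v D w -> inH1v D (a *: v + w).
Proof.
move=> vH wH i; rewrite (_ : Defs.comp _ i = a *: Defs.comp v i + Defs.comp w i).
  exact: inH1_lin.
rewrite /Defs.comp/fn/grad/=; congr pair; apply/funext => x; rewrite !fctE/=.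
  by rewrite !mxE.
by rewrite linearP.
Qed.

Lemma within_continuous_lin (V : normedModType R) (A : set E) a (f g : E -> V) :
  {within A, continuous f} -> {within A, continuous g} ->
  {within A, continuous (a *: f + g)}.
Proof.
move=> cf cg x; apply: cvgD; last exact: cg.
by apply: cvgZr; exact: cf.
Qed.

Lemma Xh_lin Th r a (v w : vfield R d) :
  Xh D Th r v -> Xh D Th r w -> Xh D Th r (a *: v + w).
Proof.
move=> [vH cv bv pv] [wH cw bw pw]; split.
- exact: inH1v_lin.
- exact: within_continuous_lin.
- by move=> x bx; rewrite -[LHS]/(a *: fn v x + fn w x) bv// bw// scaler0 addr0.
- move=> K i KTh; rewrite (_ : (fun x => _) = fun x => a * fn v x ord0 i + fn w x ord0 i).
    by apply: polynomial_on_lin; [exact: pv|exact: pw].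
  by apply/funext => x; rewrite /fn/= !fctE !mxE.
Qed.

Lemma Phih_lin Th r a (v w : sfield R d) :
  Phih D Th r v -> Phih D Th r w -> Phih D Th r (a *: v + w).
Proof.
move=> [vH cv pv] [wH cw pw]; split.
- exact: inH1_lin.
- exact: (@within_continuous_lin R^o).
- by move=> K KTh; apply: polynomial_on_lin; [exact: pv|exact: pw].
Qed.

End L2.

(** * Linear combinations inside a linear subset *)

(** The averages z_theta, z_alpha and z_beta are combinations of two or three
levels; the next lemmas treat them at once for any set P closed under the
operation a *: v + w, and any functional that is linear on P only, as is an
integral. *)
Section Combinations.
Variables (R : realType) (V : lmodType R) (P : V -> Prop).
Hypothesis Plin : forall a v w, P v -> P w -> P (a *: v + w).

(* Gives stability under scaling without assuming that 0 is in P. *)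
Let scale_as_lin a (v : V) : a *: v = (a - 1) *: v + v.
Proof. by rewrite scalerBl scale1r subrK. Qed.

Lemma closed_comb2 a b v w : P v -> P w -> P (a *: v + b *: w).
Proof. by move=> Pv Pw; apply/Plin => //; rewrite scale_as_lin; exact: Plin. Qed.

Lemma closed_comb3 a b c v w z :
  P v -> P w -> P z -> P (a *: v + b *: w + c *: z).
Proof.
by move=> Pv Pw Pz; rewrite -addrA; apply/Plin => //; exact: closed_comb2.
Qed.

Variable L : V -> R.
Hypothesis Llin : forall a v w, P v -> P w -> L (a *: v + w) = a * L v + L w.

Lemma linear_comb3 a b c v w z : P v -> P w -> P z ->
  L (a *: v + b *: w + c *: z) = a * L v + b * L w + c * L z.
Proof.
move=> Pv Pw Pz; rewrite -addrA Llin//; last exact: closed_comb2.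
have Pc : P (c *: z) by rewrite scale_as_lin; exact: Plin.
by rewrite Llin// (scale_as_lin c) Llin// -addrA; congr (_ + (_ + _)); ring.
Qed.

End Combinations.

(** * Algebra of the DLN coefficients *)

Section DLN.
Variables (R : realType) (theta : R) (t : nat -> R).
Hypothesis theta01 : 0 <= theta <= 1.

Lemma at_alphaE (V : lmodType R) (z : nat -> V) n :
  at_alpha theta z n = at_theta theta z n.+1 - at_theta theta z n.
Proof.
rewrite /at_alpha /at_theta /=.
have -> : alpha2 theta = (1 + theta) / 2 by rewrite /alpha2; field.
have -> : alpha1 theta = (1 - theta) / 2 - (1 + theta) / 2 by rewrite /alpha1; field.
have -> : alpha0 theta = - ((1 - theta) / 2) by rewrite /alpha0; field.
by rewrite scalerBl scaleNr opprD !addrA.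
Qed.

Variable n : nat.
Hypotheses (k1 : 0 < kstep t n) (k0 : 0 < kstep t n.-1).

(* Twice khat, and the numerator of 1 + veps * theta over the sum of the two
   steps. *)
Let weighted_steps_gt0 : 0 < kstep t n * (1 + theta) + kstep t n.-1 * (1 - theta).
Proof.
case/andP: theta01 => th0 th1.
by rewrite ltr_wpDr ?mulr_gt0 ?mulr_ge0// ?(ltW k0)//; lra.
Qed.

Lemma khat_gt0 : 0 < khat theta t n.
Proof. by move: weighted_steps_gt0; rewrite /khat /alpha2 /alpha0; lra. Qed.

(** This quantity is the denominator in the beta coefficients. *)
Lemma veps_theta_gt0 : 0 < 1 + veps t n * theta.
Proof.
rewrite /veps; have s0 : 0 < kstep t n + kstep t n.-1 by exact: addr_gt0.
have -> : 1 + (kstep t n - kstep t n.-1) / (kstep t n + kstep t n.-1) * theta =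
   (kstep t n * (1 + theta) + kstep t n.-1 * (1 - theta))
   / (kstep t n + kstep t n.-1) by field; exact: lt0r_neq0.
exact: divr_gt0.
Qed.

Variables (d : nat) (D : set 'rV[R]_d).
Hypotheses (mD : measurable D) (Dfin : (lebesgue_rV R d D < +oo)%E)
  (bD : bounded_set D).

Lemma ip_at_betar m k (f : 'rV[R]_d -> 'M[R]_(m, k)) z :
  inL2m D f -> (forall j, (j <= n.+1)%N -> inL2m D (z j)) ->
  ip D f (at_beta theta t z n) =
  beta2 theta t n * ip D f (z n.+1) + beta1 theta t n * ip D f (z n)
  + beta0 theta t n * ip D f (z n.-1).
Proof.
move=> fL zL; rewrite /at_beta (@linear_comb3 _ _ (@inL2m _ _ D m k))//.
- exact: inL2m_lin.
- by move=> *; rewrite ipC ip_linl// !(ipC D f).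
- exact: zL.
- by apply: zL; exact: leqnSn.
- by apply: zL; rewrite (leq_trans (leq_pred n)).
Qed.

(** The G-stability of the DLN method.  With e = veps, the difference of the two
sides is g |delta|^2, where
   delta = z_n - (1 - e)/2 z_{n+1} - (1 + e)/2 z_{n-1}  and
   g = theta (1 - theta^2) / (2 (1 + e theta)^2) >= 0.
Once both sides are expanded by bilinearity into the six products of levels,
this is a rational identity in theta and e. *)
Lemma G_stability m k (z : nat -> 'rV[R]_d -> 'M[R]_(m, k)) :
  (forall j, (j <= n.+1)%N -> inL2m D (z j)) ->
  Gnorm D theta (z n.+1) (z n) - Gnorm D theta (z n) (z n.-1) <=
  ip D (at_alpha theta z n) (at_beta theta t z n).
Proof.
move=> zL; have q0 := veps_theta_gt0.
set e := veps t n in q0 *.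
have z2 := zL _ (leqnn _); have z1 := zL _ (leqnSn n).
have z0 : inL2m D (z n.-1) by apply: zL; rewrite (leq_trans (leq_pred n)).
have L2lin := @inL2m_lin R d D m k.
have comb3l a b c (f : 'rV[R]_d -> 'M[R]_(m, k)) : inL2m D f ->
    ip D (a *: z n.+1 + b *: z n + c *: z n.-1) f =
    a * ip D (z n.+1) f + b * ip D (z n) f + c * ip D (z n.-1) f.
  move=> fL; apply: (@linear_comb3 _ _ (@inL2m _ _ D m k) L2lin (fun g => ip D g f)) => //.
  by move=> *; exact: ip_linl.
pose delta := (- (1 - e) / 2) *: z n.+1 + 1 *: z n + (- (1 + e) / 2) *: z n.-1.
have dL : inL2m D delta by exact: (closed_comb3 L2lin).
pose g := theta * (1 - theta ^+ 2) / (2 * (1 + e * theta) ^+ 2).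
have g0 : 0 <= g.
  rewrite divr_ge0// ?mulr_ge0 ?sqr_ge0//; move/andP: theta01 => [? ?]; nra.
rewrite /Gnorm !normL2_sqr /at_alpha /at_beta.
suff -> : ip D (alpha2 theta *: z n.+1 + alpha1 theta *: z n + alpha0 theta *: z n.-1)
    (beta2 theta t n *: z n.+1 + beta1 theta t n *: z n + beta0 theta t n *: z n.-1) =
  4^-1 * (1 + theta) * ip D (z n.+1) (z n.+1) +
      4^-1 * (1 - theta) * ip D (z n) (z n) -
      (4^-1 * (1 + theta) * ip D (z n) (z n) +
       4^-1 * (1 - theta) * ip D (z n.-1) (z n.-1)) + g * ip D delta delta.
  by rewrite lerDl mulr_ge0// ip_ge0.
have dz f : inL2m D f -> ip D f delta = - (1 - e) / 2 * ip D f (z n.+1) + 1 * ip D f (z n)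
   + - (1 + e) / 2 * ip D f (z n.-1) by move=> fL; rewrite ipC comb3l// !(ipC D f).
rewrite comb3l; last exact: (closed_comb3 L2lin).
rewrite !(ipC D _ (beta2 theta t n *: _ + _ + _)) !comb3l// !dz//.
rewrite (ipC D (z n) (z n.+1)) (ipC D (z n.-1) (z n.+1)) (ipC D (z n.-1) (z n)).
rewrite /g /beta2 /beta1 /beta0 /alpha2 /alpha1 /alpha0 -/e.
by field; exact: lt0r_neq0.
Qed.

End DLN.

(** * The double-well potential *)

Section Potential.
Variables (R : realType) (c : params R).

Lemma ftildeM (a b : R) : ftilde c a b * (a - b) = Fpot c a - Fpot c b.
Proof.
rewrite /ftilde; case: eqVneq => [->|ab] /=; first by rewrite !subrr mulr0.
by rewrite divfK// subr_eq0.
Qed.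

Lemma continuous_Fpot : continuous (Fpot c).
Proof.
move=> x; apply: cvgM; first exact: cvg_cst.
apply: (@cvg_comp _ _ _ (fun a : R => a ^+ 2 - 1) (fun b : R => b ^+ 2)).
  apply: cvgB; last exact: cvg_cst.
  exact: exprn_continuous.
exact: exprn_continuous.
Qed.

End Potential.

(** * Integrability of finite element fields *)

Section FiniteElements.
Variables (R : realType) (d : nat) (D : set 'rV[R]_d).
Variables (Th : seq 'M[R]_(d.+1, d)) (r : nat).
Hypotheses (mD : measurable D) (Dfin : (lebesgue_rV R d D < +oo)%E)
  (bD : bounded_set D).
Local Notation E := 'rV[R]_d.
Local Notation leb := (lebesgue_rV R d).

Lemma Xh_fn_inL2 v : Xh D Th r v -> inL2m D (fn v).
Proof. by case=> vH _ _ _ i j; rewrite ord1; have [] := vH j. Qed.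

Lemma Xh_grad_inL2 v : Xh D Th r v -> inL2m D (grad v).
Proof.
case=> vH _ _ _ i j; have [_ /(_ j)] := vH i.
by under eq_fun do rewrite /Defs.comp/= mxE.
Qed.

Lemma Xh_divg_inL2 v : Xh D Th r v -> inL2 D (divg v).
Proof. by move=> vX; apply: inL2_sum => // i; exact: Xh_grad_inL2. Qed.

Lemma Phih_grad_inL2 v : Phih D Th r v -> inL2m D (grad v).
Proof. by case=> -[_ vL _] _ _ i j; rewrite ord1; exact: vL. Qed.

(** F is quartic, so square integrability of v would not suffice: what is used
is that v is bounded on D, being continuous on its closure. *)
Lemma Fpot_integrable (c : params R) v : Phih D Th r v ->
  leb.-integrable D (EFin \o (fun x => Fpot c (fn v x))).
Proof.
move=> [[vL _ _] cv _]; apply: measurable_bounded_integrable => //.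
  apply: (measurableT_comp _ (inL2_measurable mD vL)).
  by apply: continuous_measurable_fun; exact: continuous_Fpot.
apply: (@continuous_bounded _ _ _ bD R^o) => x.
apply: (@continuous_comp _ _ _ (fn v : subspace (closure D) -> R) (Fpot c)).
  exact: cv.
exact: continuous_Fpot.
Qed.

Lemma ips_divg_lin (q : E -> R) a v w : inL2 D q -> Xh D Th r v -> Xh D Th r w ->
  ips D q (divg (a *: v + w)) = a * ips D q (divg v) + ips D q (divg w).
Proof.
move=> qL vX wX; rewrite -ips_linr//; try exact: Xh_divg_inL2.
by congr ips; apply/funext => x; rewrite /divg /grad/= !fctE linearP.
Qed.

End FiniteElements.

(** * One step of the energy law *)

(** The real arithmetic of the energy law.  K is 1 / khat, A and B are the
products (u_alpha, u_beta) and (phi_alpha, m_beta), X is the power exchanged by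
the capillary force, S the dissipation sigma |m_beta|^2, and Q the product of
grad phi_alpha and grad phi_beta. *)
Lemma energy_balance (R : realType)
    (K A B X S kap Q F1 F0 gu1 gu0 gp1 gp0 : R) :
  0 < K -> K * A <= X -> K * B + X = - S -> 0 <= S ->
  B = kap * Q + kap * (F1 - F0) ->
  gu1 - gu0 <= A -> gp1 - gp0 <= Q -> 0 < kap ->
  gu1 + kap * (gp1 + F1) <= gu0 + kap * (gp0 + F0).
Proof.
move=> K0 KA KB S0 BE uA pQ kap0.
have AB : A + B <= 0 by rewrite -(pmulr_rle0 _ K0); lra.
have kpQ : kap * (gp1 - gp0) <= kap * Q by rewrite ler_pM2l.
lra.
Qed.

Section EnergyStep.
Variables (R : realType) (d : nat) (D : set 'rV[R]_d) (c : params R).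
Variables (Th : seq 'M[R]_(d.+1, d)) (r : nat) (theta : R) (t : nat -> R).
Variables (u w : nat -> vfield R d) (xi p : nat -> 'rV[R]_d -> R).
Variables (phi m : nat -> sfield R d) (n : nat).
Hypotheses (mD : measurable D) (Dfin : (lebesgue_rV R d D < +oo)%E)
  (bD : bounded_set D).
Hypotheses (cadm : admissible c) (rho0 : 0 <= rho c) (theta01 : 0 <= theta <= 1).
Hypotheses (k1 : 0 < kstep t n) (k0 : 0 < kstep t n.-1).
Hypothesis spaces : forall j, (j <= n.+1)%N ->
  [/\ Xh D Th r (u j), Xh D Th r (w j), Qh D Th r (xi j) /\ Qh D Th r (p j),
      Phih D Th r (phi j) & Phih D Th r (m j)].
Hypothesis constraints : forall j, (j <= n.+1)%N ->
  constraint_eqs D Th r u w xi j.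

Local Notation E := 'rV[R]_d.
Local Notation leb := (lebesgue_rV R d).
Local Notation beta z := (at_beta theta t z n).
Local Notation alpha z := (at_alpha theta z n).

Let uX j : (j <= n.+1)%N -> Xh D Th r (u j). Proof. by move=> /spaces[]. Qed.
Let wX j : (j <= n.+1)%N -> Xh D Th r (w j). Proof. by move=> /spaces[]. Qed.
Let xiL j : (j <= n.+1)%N -> inL2 D (xi j). Proof. by move=> /spaces[_ _ [[[]]]]. Qed.
Let pL j : (j <= n.+1)%N -> inL2 D (p j). Proof. by move=> /spaces[_ _ [_ [[]]]]. Qed.
Let phiX j : (j <= n.+1)%N -> Phih D Th r (phi j). Proof. by move=> /spaces[]. Qed.
Let mX j : (j <= n.+1)%N -> Phih D Th r (m j). Proof. by move=> /spaces[]. Qed.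
Let le_next : (n.+1 <= n.+1)%N. Proof. by []. Qed.
Let le_cur : (n <= n.+1)%N. Proof. exact: leqnSn. Qed.
Let le_prev : (n.-1 <= n.+1)%N. Proof. exact: leq_trans (leq_pred n) le_cur. Qed.

Let XhP := @Xh_lin R d D mD Dfin bD Th r.
Let PhihP := @Phih_lin R d D mD Dfin bD Th r.

Lemma Xh_beta (z : nat -> vfield R d) :
  (forall j, (j <= n.+1)%N -> Xh D Th r (z j)) -> Xh D Th r (beta z).
Proof. by move=> zX; apply: (closed_comb3 XhP); exact: zX. Qed.

Lemma Phih_beta (z : nat -> sfield R d) :
  (forall j, (j <= n.+1)%N -> Phih D Th r (z j)) -> Phih D Th r (beta z).
Proof. by move=> zX; apply: (closed_comb3 PhihP); exact: zX. Qed.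

Lemma Phih_alpha (z : nat -> sfield R d) :
  (forall j, (j <= n.+1)%N -> Phih D Th r (z j)) -> Phih D Th r (alpha z).
Proof. by move=> zX; apply: (closed_comb3 PhihP); exact: zX. Qed.

Lemma ips_betal (z : nat -> E -> R) f : inL2 D f ->
  (forall j, (j <= n.+1)%N -> inL2 D (z j)) ->
  ips D (beta z) f = beta2 theta t n * ips D (z n.+1) f
    + beta1 theta t n * ips D (z n) f + beta0 theta t n * ips D (z n.-1) f.
Proof.
move=> fL zL; apply: (@linear_comb3 R (E -> R^o) (inL2 D) _ (fun g => ips D g f)).
- exact: inL2_lin.
- by move=> *; exact: ips_linl.
all: exact: zL.
Qed.

Lemma ips_divg_beta (z : nat -> vfield R d) q : inL2 D q ->
  (forall j, (j <= n.+1)%N -> Xh D Th r (z j)) ->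
  ips D q (divg (beta z)) = beta2 theta t n * ips D q (divg (z n.+1))
    + beta1 theta t n * ips D q (divg (z n))
    + beta0 theta t n * ips D q (divg (z n.-1)).
Proof.
move=> qL zX.
apply: (@linear_comb3 R _ (Xh D Th r) XhP (fun v => ips D q (divg v))).
- by move=> a v v1 vX v1X; exact: (ips_divg_lin mD Dfin bD a qL vX v1X).
all: exact: zX.
Qed.

(** The continuity equation is tested with pressures, one time level against
another; each of the nine products of a pressure and a divergence vanishes. *)
Lemma pressure_work0 : ips D (beta p) (divg (beta u)) = 0.
Proof.
have ub := Xh_beta uX.
rewrite ips_betal//; last exact: Xh_divg_inL2 ub.
suff pu j : (j <= n.+1)%N -> ips D (p j) (divg (beta u)) = 0.
  by rewrite !pu// !mulr0 !addr0.
move=> jn; have [_ _ [_ pQ] _ _] := spaces jn.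
have div0 i : (i <= n.+1)%N -> ips D (p j) (divg (u i)) = 0.
  by move=> /constraints[_ /(_ _ pQ) <- _]; rewrite ipsC.
by rewrite ips_divg_beta ?div0 ?mulr0 ?addr0//; exact: pL.
Qed.

(** Testing the equation that relates w_j and u_j with w_beta kills the
multiplier xi_j, as w_beta is discretely divergence free; averaging over the
levels j leaves (grad u_beta, grad w_beta) = |w_beta|^2. *)
Lemma coupling_work_ge0 : 0 <= ip D (grad (beta w)) (grad (beta u)).
Proof.
have wb := Xh_beta wX.
have gL j : (j <= n.+1)%N -> inL2m D (grad (u j)).
  by move=> /uX; exact: Xh_grad_inL2.
suff -> : ip D (grad (beta w)) (grad (beta u)) = ip D (fn (beta w)) (fn (beta w)).
  exact: ip_ge0.
have wdiv0 j : (j <= n.+1)%N -> ips D (xi j) (divg (beta w)) = 0.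
  move=> jn; have [_ _ [xQ _] _ _] := spaces jn.
  have div0 i : (i <= n.+1)%N -> ips D (xi j) (divg (w i)) = 0.
    by move=> /constraints[_ _ /(_ _ xQ) <-]; rewrite ipsC.
  by rewrite ips_divg_beta ?div0 ?mulr0 ?addr0//; exact: xiL.
have uw j : (j <= n.+1)%N ->
    ip D (grad (beta w)) (grad (u j)) = ip D (fn (beta w)) (fn (w j)).
  move=> jn; rewrite ipC [RHS]ipC; have [/(_ _ wb)+ _ _] := constraints jn.
  by rewrite wdiv0// subr0 => <-.
rewrite (@ip_at_betar R theta t n d D mD _ _ _ (fun j => grad (u j)))//; last first.
  exact: Xh_grad_inL2 wb.
rewrite !uw// -(@ip_at_betar R theta t n d D mD _ _ _ (fun j => fn (w j)))//.
  exact: Xh_fn_inL2 wb.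
by move=> j /wX; exact: Xh_fn_inL2.
Qed.

Hypotheses (mom : momentum_eq D Th r c theta t u w p phi m n)
  (pha : phase_eq D Th r c theta t u phi m n)
  (pot : potential_eq D Th r c theta t phi m n).

(** The power of the capillary force bounds the kinetic energy increment: all
the other terms of the momentum equation tested with u_beta vanish or
dissipate. *)
Lemma momentum_bound :
  (khat theta t n)^-1 * ip D (fn (alpha u)) (fn (beta u)) <=
  ip D (fun x => fn (beta m) x *: grad (beta phi) x) (fn (beta u)).
Proof.
have [[mu0 gamma0 nu0] lambda0 _ _ _] := cadm.
have /mom <- := Xh_beta uX.
rewrite pressure_work0 subr0 /bform subrr mulr0 addr0 -!addrA lerDl.
apply: addr_ge0; first exact: mulr_ge0 mu0 (ip_ge0 _ _).
apply: addr_ge0; first exact: mulr_ge0 gamma0 coupling_work_ge0.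
apply: addr_ge0; first exact: mulr_ge0 rho0 (ip_ge0 _ _).
apply: (mulr_ge0 lambda0); apply: Rintegral_ge0 => x _.
rewrite frobZl; exact: mulr_ge0 (frob_ge0 _) (frob_ge0 _).
Qed.

(** The modified nonlinearity is a discrete gradient of F, and phi_alpha is the
very increment of phi_theta that it is the quotient over. *)
Lemma potential_increment :
  ips D (fun x => ftilde c (fn (at_theta theta phi n.+1) x)
                           (fn (at_theta theta phi n) x)) (fn (alpha phi)) =
  \int[leb]_(x in D) Fpot c (fn (at_theta theta phi n.+1) x) -
  \int[leb]_(x in D) Fpot c (fn (at_theta theta phi n) x).
Proof.
have th j : (j <= n.+1)%N -> (j.-1 <= n.+1)%N -> Phih D Th r (at_theta theta phi j).
  by move=> j1 j0; apply: (closed_comb2 PhihP); exact: phiX.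
have F1 := Fpot_integrable mD Dfin bD c (th _ le_next le_cur).
have F0 := Fpot_integrable mD Dfin bD c (th _ le_cur le_prev).
rewrite -(RintegralB mD F1 F0); apply: eq_Rintegral => x _.
by rewrite -ftildeM at_alphaE.
Qed.

Lemma energy_step : (0 < n)%N ->
  energy D c theta u phi n <= energy D c theta u phi n.-1.
Proof.
move=> n0; have [_ _ sigma0 kappa0 _] := cadm.
have mb := Phih_beta mX.
rewrite /energy (prednK n0).
have Gu := @G_stability R theta t theta01 n k1 k0 d D mD _ _ (fun j => fn (u j))
  (fun j jn => Xh_fn_inL2 (uX jn)).
have Gphi := @G_stability R theta t theta01 n k1 k0 d D mD _ _ (fun j => grad (phi j))
  (fun j jn => Phih_grad_inL2 (phiX jn)).
(* the capillary power is the transport term of the phase equation *)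
have coupling : ip D (fun x => fn (beta m) x *: grad (beta phi) x) (fn (beta u)) =
    ips D (fun x => frob (fn (beta u) x) (grad (beta phi) x)) (fn (beta m)).
  by apply: eq_Rintegral => x _; rewrite frobZl frobC mulrC.
have mm : 0 <= sigma c * ips D (fn (beta m)) (fn (beta m)).
  apply: mulr_ge0; first exact: ltW.
  by apply: Rintegral_ge0 => x _; rewrite -expr2; exact: sqr_ge0.
have hm := momentum_bound; have hp := pha mb.
have := pot (Phih_alpha phiX); rewrite potential_increment ipsC => hs.
rewrite coupling in hm.
have kh : 0 < (khat theta t n)^-1 by rewrite invr_gt0; exact: khat_gt0.
rewrite mulNr in hp; rewrite [ip D (grad (beta phi)) _]ipC in hs.
exact: energy_balance kh hm hp mm hs Gu Gphi kappa0.
Qed.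

End EnergyStep.

Theorem theorem4p4 (R : realType) (d : nat) (D : set 'rV[R]_d)
    (c : params R) (h creg : R) (Th : seq 'M[R]_(d.+1, d)) (r : nat)
    (theta T : R) (M : nat) (t : nat -> R)
    (u w : nat -> vfield R d) (xi p : nat -> 'rV[R]_d -> R)
    (phi m : nat -> sfield R d)
    (d23 : d = 2%N \/ d = 3%N) (domD : lipschitz_domain D)
    (cadm : admissible c)
    (h01 : 0 < h < 1) (triTh : regular_triangulation D h creg Th)
    (r1 : (1 <= r)%N) (lbb : inf_sup D Th r)
    (theta01 : 0 <= theta <= 1)
    (T0 : 0 < T) (M2 : (2 <= M)%N)
    (t0 : t 0%N = 0) (tM : t M = T)
    (tincr : forall n : nat, (n < M)%N -> t n < t n.+1)
    (sol : dln_solution D Th r c theta t M u w xi p phi m)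
    (rho0 : 0 <= rho c) :
  forall n : nat, (n <= M - 2)%N ->
    energy D c theta u phi n.+1 <= energy D c theta u phi n.
Proof.
move=> n nM; have n2M : (n.+2 <= M)%N by rewrite -(subnK M2) addn2 !ltnS.
have [oD _ _ bD _] := domD; have mD := open_measurable_rV oD.
have Dfin := lebesgue_rV_bounded_lty mD bD.
have [spaces c0 c1 step] := sol.
have [mom _ pha pot] := step n.+1 n2M.
apply: (@energy_step R d D c Th r theta t u w xi p phi m n.+1) => //.
- by rewrite /kstep subr_gt0 tincr.
- by rewrite /kstep subr_gt0 tincr// ltnW.
- by move=> j jn; apply: spaces; exact: leq_trans jn n2M.
move=> [|[|j]] jn //; have [|//] := step j.+1.
by rewrite (leq_trans jn n2M).
Qed.
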